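(* For every finite simple graph $G$ with $\mu(G)\geq 1$, $$a(G)-\alpha(G)\leq 2\mu(G)+1-\left\lceil\sqrt{6\mu(G)}\right\rceil .$$ Moreover, this bound is exact for every prescribed positive matching number: for every integer $\mu\geq 1$ there exists a finite simple graph $G$ with $\mu(G)=\mu$ and $a(G)-\alpha(G)=2\mu+1-\lceil\sqrt{6\mu}\rceil$.
   Context: All graphs are finite, simple and undirected. For a graph $G$, $n(G)$ and $m(G)$ are the numbers of vertices and edges, $\alpha(G)$ is the independence number (maximum size of a set of pairwise non-adjacent vertices), and $\mu(G)$ is the matching number (maximum size of a set of pairwise disjoint edges). If $d_1\leq d_2\leq\cdots\leq d_n$ is the degree sequence of $G$, the annihilation number is $a(G)=\max\{k : \sum_{i=1}^k d_i\leq m(G)\}$; equivalently, it is the maximum size of a set $A\subseteq V(G)$ with $\sum_{v\in A}d(v)\leq m(G)$. *)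

(* Defs.v *)
From mathcomp Require Import all_boot.

Set Implicit Arguments.
Unset Strict Implicit.
Unset Printing Implicit Defensive.

Record sgraph := SGraph {
  vertex :> finType;
  adj : rel vertex;
  adj_sym : symmetric adj;
  adj_irrefl : irreflexive adj
}.

(* An edge is the unordered pair of its endpoints; it has exactly two elements
   because adj is irreflexive. *)
Definition edges (G : sgraph) : {set {set G}} :=
  [set [set x; y] | x in G, y in G & adj x y].

Definition nb_edges (G : sgraph) : nat := #|edges G|.

Definition degree (G : sgraph) (v : G) : nat := #|[set w | adj v w]|.

Definition independent (G : sgraph) (S : {set G}) : bool :=
  [forall x in S, forall y in S, ~~ adj x y].

Definition independence_number (G : sgraph) : nat :=
  \max_(S : {set G} | independent S) #|S|.

Definition matching (G : sgraph) (M : {set {set G}}) : bool :=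
  (M \subset edges G) && trivIset M.

Definition matching_number (G : sgraph) : nat :=
  \max_(M : {set {set G}} | matching M) #|M|.

Definition degree_sequence (G : sgraph) : seq nat :=
  sort leq [seq degree v | v <- enum G].

(* The bound k <= #|G| is essential: take k s is s itself for k > size s. *)
Definition annihilation_number (G : sgraph) : nat :=
  \max_(k < #|G|.+1 | sumn (take k (degree_sequence G)) <= nb_edges G) k.

(* Main.v *)
(* Let A be a set of size k = a(G) with degree sum at most m(G), and let B be its
   complement, of size b. Counting edges by their endpoints in A gives
   e(A) <= e(B). Three estimates then bound 6 mu by (2 mu + 1 + alpha - k)^2:
   - the vertices missed by a maximal matching are independent, so
     k + b <= 2 mu + alpha;
   - 2 k <= e(A) + mu(A) + 2 alpha;
   - if a maximal matching of B has y edges, the b - 2 y vertices it misses span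
     no edge, so e(B) <= C(b, 2) - C(b - 2 y, 2), while mu(A) + y <= mu.
   For sharpness, put s = ceil(sqrt(6 mu)) and h = floor(s / 2), and take the
   disjoint union of K_(2h+1) and mu - h triangles; the annihilating set consists
   of all the triangles together with 2h + 2 - s vertices of the big clique. *)
Require Import Defs.
From mathcomp Require Import all_boot all_order all_algebra.
From mathcomp Require Import reals zify.

Set Implicit Arguments.
Unset Strict Implicit.
Unset Printing Implicit Defensive.

(** * Arithmetic of the upper bound *)

(* For a graph of order [n], matching number [mu] and independence number [al]:
   [k], [eA] and [x] count the vertices, edges and matching edges of [A], while
   [b], [eB] and [y] do so for its complement. *)
Lemma annihilation_arith (k b n mu al eA eB x y : nat) :
    k + b = n -> n <= 2 * mu + al -> 2 * k <= eA + x + 2 * al ->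
    x <= eA -> eA <= eB -> eB + 'C(b - 2 * y, 2) <= 'C(b, 2) ->
    2 * y <= b -> x + y <= mu ->
  k <= 2 * mu + 1 + al /\ 6 * mu <= (2 * mu + 1 + al - k) ^ 2.
Proof.
move=> <- n_le leA xA eAB eB_le /subnKC; move: eB_le.
move: (b - 2 * y) => z eB_le bE xy; split; first by lia.
(* [e] is the slack in [n <= 2 * mu + al]; the target becomes [6 * mu <= (b + e + 1) ^ 2]. *)
have [e eE] : exists e, 2 * mu + al = k + b + e.
  by exists (2 * mu + al - (k + b)); lia.
have -> : 2 * mu + 1 + al - k = b + e + 1 by lia.
have tri m : 2 * 'C(m, 2) + m = m ^ 2.
  by elim: m => // m; rewrite binS bin1; lia.
have tb := tri b; have tz := tri z.
(* Eliminating [k], [x], [y] and the edge counts leaves [6 * mu <= b ^ 2 + 2 * b + 4 * e + 2 * z - z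
   ^ 2]; the square of [z - 1] removes [z]. *)
have tangent : 2 * z <= z ^ 2 + 1 by case: z {eB_le bE tz} => [|z] //; nia.
(* The term [4 * e] is absorbed through [e <= b * e], which needs [b > 0]. If [b = 0], then
   [eB = eA = x = 0], whence [2 * mu <= e]. *)
have [b0|b_gt0] := posnP b.
  by rewrite b0 in eB_le tb *; rewrite bin0n in eB_le tb; nia.
have be : e <= b * e by rewrite leq_pmull.
suff : 6 * mu <= b ^ 2 + e ^ 2 + 1 + 2 * (b * e) + 2 * b + 2 * e by nia.
lia.
Qed.

(** * Sorted sequences and sums over an option type *)

(** When the heads differ, the head of [s] is a minimum of [s], hence at most the head of [t]. This
    compares a prefix of the degree sequence with an arbitrary vertex set. *)
Lemma sumn_take_le_subseq (s t : seq nat) :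
  sorted leq s -> subseq t s -> sumn (take (size t) s) <= sumn t.
Proof.
elim: s t => [|x s IHs] [|y t] //= ps; have ss := path_sorted ps.
have xs z : z \in s -> x <= z by move: z; apply/allP/(order_path_min leq_trans).
case: eqP => [->|_] sub; first by rewrite leq_add2l IHs.
rewrite leq_add ?xs ?(mem_subseq sub) ?mem_head // IHs //.
exact: subseq_trans (subseq_cons t y) sub.
Qed.

Lemma sum_option (T : finType) (F : option T -> nat) :
  \sum_c F c = F None + \sum_i F (Some i).
Proof.
rewrite (bigD1 None) //=; congr (_ + _).
rewrite (reindex_omap Some id) => [|[i|] //]; apply: eq_bigl => i.
by rewrite eqxx.
Qed.

(** * Edges, degrees and double counting *)

Section Graph.

Variable G : sgraph.
Implicit Types (x y v w : G) (E S A : {set G}) (M : {set {set G}}).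

Definition edges_in S : {set {set G}} := [set E in edges G | E \subset S].

Lemma edgesP E :
  reflect (exists x y, adj x y /\ E = [set x; y]) (E \in edges G).
Proof.
apply: (iffP imset2P) => [[x y _]|[x [y [xy ->]]]].
  by rewrite inE => /andP[_ xy] ->; exists x, y.
by exists x y; rewrite ?inE.
Qed.

Lemma adj_neq x y : adj x y -> x != y.
Proof. by apply: contraTneq => ->; rewrite adj_irrefl. Qed.

Lemma edge_set2 x y : ([set x; y] \in edges G) = adj x y.
Proof.
apply/edgesP/idP => [[u [v [uv e]]]|xy]; last by exists x, y.
have : x != y by have := cards2 x y; rewrite e cards2 (adj_neq uv); case: eqP.
have := set22 x y; have := set21 x y; rewrite e !inE.
by move=> /orP[]/eqP-> /orP[]/eqP->; rewrite ?eqxx // adj_sym.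
Qed.

Lemma card_edge E : E \in edges G -> #|E| = 2.
Proof. by case/edgesP=> x [y [/adj_neq xy ->]]; rewrite cards2 xy. Qed.

Lemma edge_at v E : E \in edges G -> v \in E -> exists2 w, adj v w & E = [set v; w].
Proof.
case/edgesP=> x [y [xy ->]]; rewrite !inE => /orP[]/eqP->; first by exists y.
by exists x; rewrite 1?adj_sym // setUC.
Qed.

Lemma degree_edges v : degree v = #|[set E in edges G | v \in E]|.
Proof.
rewrite /degree -(@card_in_imset _ _ (fun w => [set v; w])).
  apply: eq_card => E; rewrite !inE; apply/imsetP/andP => [[w]|[EG vE]].
    by rewrite inE => vw ->; rewrite edge_set2 vw !inE eqxx.
  by have [w vw ->] := edge_at EG vE; exists w; rewrite ?inE.
move=> w u; rewrite !inE => /adj_neq vw _ /setP/(_ w).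
by rewrite !inE eqxx orbT eq_sym (negPf vw) => /esym/eqP.
Qed.

Lemma sum_degree A :
  \sum_(v in A) degree v = \sum_(E in edges G) #|E :&: A|.
Proof.
under eq_bigr => v _ do rewrite degree_edges -sum1_card.
under [RHS]eq_bigr => E _ do rewrite -sum1_card.
rewrite (exchange_big_dep (mem (edges G))) /= => [|v E _]; last first.
  by rewrite inE => /andP[].
apply: eq_bigr => E EG; apply: eq_bigl => v.
by rewrite !inE EG andbC.
Qed.

Lemma handshake : \sum_(v : G) degree v = 2 * nb_edges G.
Proof.
transitivity (\sum_(v in [set: G]) degree v).
  by apply: eq_bigl => v; rewrite inE.
rewrite sum_degree mulnC -sum_nat_const; apply: eq_bigr => E /card_edge <-.
by rewrite setIT.
Qed.

(** Edge by edge, the number of ends in [A] plus the indicator of avoiding [A] is one plus the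
    indicator of lying inside [A]. *)
Lemma sum_degree_edges_in A :
  \sum_(v in A) degree v + #|edges_in (~: A)| = nb_edges G + #|edges_in A|.
Proof.
have cE S : #|edges_in S| = \sum_(E in edges G) (E \subset S).
  rewrite -sum1_card (eq_bigl (fun E => (E \in edges G) && (E \subset S))).
    by rewrite big_mkcondr; apply: eq_bigr => E _; case: ifP.
  by move=> E; rewrite inE.
rewrite sum_degree !cE /nb_edges -sum1_card -!big_split /=.
apply: eq_bigr => E /edgesP[x [y [/adj_neq xy ->]]].
rewrite !subUset !sub1set !inE setIUl.
have c1 z : #|[set z] :&: A| = (z \in A).
  case: (boolP (z \in A)) => zA; first by rewrite (setIidPl _) ?sub1set ?cards1.
  by apply: eq_card0 => u; rewrite !inE; case: eqP => // ->; rewrite (negPf zA).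
rewrite cardsU !c1 (_ : _ :&: _ = set0) ?cards0.
  by case: (x \in A); case: (y \in A).
apply/setP=> u; rewrite !inE; case: eqP => //= ->.
by rewrite (negPf xy) andbF.
Qed.

(** * Matchings and independent sets *)

Lemma card_cover_matching M :
  M \subset edges G -> trivIset M -> #|cover M| = 2 * #|M|.
Proof.
move=> MG /eqP <-; rewrite mulnC -sum_nat_const; apply: eq_bigr => E EM.
exact/card_edge/(subsetP MG).
Qed.

Lemma edges_in_sub S : edges_in S \subset edges G.
Proof. by apply/subsetP=> E; rewrite inE => /andP[]. Qed.

Lemma edges_inS S A : S \subset A -> edges_in S \subset edges_in A.
Proof.
move=> SA; apply/subsetP=> E; rewrite !inE => /andP[-> /subset_trans]; exact.
Qed.

Lemma cover_edges_in S M : M \subset edges_in S -> cover M \subset S.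
Proof.
by move=> MS; apply/bigcupsP=> E /(subsetP MS); rewrite inE => /andP[].
Qed.

Lemma set2_matchingU x y M :
    adj x y -> M \subset edges G -> trivIset M ->
    x \notin cover M -> y \notin cover M ->
  trivIset ([set x; y] |: M) /\ #|[set x; y] |: M| = #|M|.+1.
Proof.
move=> xy MG tM xM yM.
have d E : E \in M -> [disjoint [set x; y] & E].
  move=> EM; rewrite disjoints_subset subUset !sub1set !inE.
  have h z : z \notin cover M -> z \notin E.
    by apply: contra => zE; apply/bigcupP; exists E.
  by rewrite !h.
(* The side condition excludes the empty set from [M]. *)
have [|tM' nM] := trivIsetU1 d tM; last by rewrite cardsU1 nM.
by apply/negP=> /(subsetP MG)/card_edge; rewrite cards0.
Qed.

Lemma independentP S :
  reflect {in S &, forall x y, ~~ adj x y} (independent S).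
Proof.
apply: (iffP forall_inP) => [h x y xS|h x xS].
  by move/forall_inP: (h x xS); apply.
by apply/forall_inP=> y; apply: h.
Qed.

(** Maximality under inclusion suffices: an edge joining two uncovered vertices of [S] could be
    added to [M]. *)
Lemma exists_maximal_matching S : exists M,
  [/\ M \subset edges_in S, trivIset M & independent (S :\: cover M)].
Proof.
pose P M := (M \subset edges_in S) && trivIset M.
have P0 : P set0 by rewrite /P sub0set /trivIset /cover !big_set0 cards0.
have [M /maxsetP[/andP[MS tM] maxM] _] := maxset_exists P0.
exists M; split=> //; apply/independentP=> x y; rewrite !inE.
move=> /andP[xM xS] /andP[yM yS]; apply/negP => xy.
have [t _] := set2_matchingU xy (subset_trans MS (edges_in_sub S)) tM xM yM.
have : [set x; y] \in M.
  rewrite -(maxM ([set x; y] |: M)) ?subsetUr ?setU11 // /P t andbT subUset MS.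
  by rewrite sub1set inE edge_set2 xy subUset !sub1set xS yS.
by move=> h; case/bigcupP: xM; exists [set x; y]; rewrite ?inE ?eqxx.
Qed.

Lemma edges_inD1 v S : v \in S ->
  #|edges_in S| = #|edges_in (S :\ v)| + #|[set E in edges_in S | v \in E]|.
Proof.
move=> vS; rewrite -(cardsID [set E : {set G} | v \in E] (edges_in S)) addnC.
congr (_ + _).
  by apply: eq_card => E; rewrite !inE subsetD1 andbC -andbA.
by apply: eq_card => E; rewrite !inE.
Qed.

(* Peel off a vertex [v] of [S]: an isolated vertex joins [I]; a pendant vertex
   joins [I] while its edge joins [M] and its neighbour is discarded; any other
   vertex takes at least two edges away. *)
Lemma card_le_edges_matching_independent S : exists (I : {set G}) (M : {set {set G}}),
  [/\ I \subset S, independent I, M \subset edges_in S, trivIset M &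
      2 * #|S| <= #|edges_in S| + #|M| + 2 * #|I|].
Proof.
have [n] := ubnP #|S|; elim: n S => // n IHn S leS.
have [->|[v vS]] := set_0Vmem S.
  exists set0, set0; rewrite !sub0set !cards0 !muln0; split=> //.
    by apply/independentP=> x; rewrite inE.
  by rewrite /trivIset /cover !big_set0 cards0.
have cS := cardsD1 v S; rewrite vS add1n in cS.
have leSv : #|S :\ v| < n by move: leS; rewrite cS.
have eS := edges_inD1 vS.
have SvS : S :\ v \subset S by rewrite subsetDl.
have isoI (I : {set G}) : I \subset S :\ v -> independent I ->
    (forall w, w \in I -> ~~ adj v w) ->
    [/\ v |: I \subset S, independent (v |: I) & #|v |: I| = #|I|.+1].
  move=> IS indI vI; split.
  - by rewrite subUset sub1set vS (subset_trans IS SvS).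
  - apply/independentP=> x y; rewrite !inE.
    move=> /orP[/eqP->|xI] /orP[/eqP->|yI]; rewrite ?adj_irrefl //.
    + exact: vI.
    + by rewrite adj_sym vI.
    + exact: (independentP _ indI).
  - rewrite cardsU1 (_ : v \notin I) //; apply/negP => /(subsetP IS).
    by rewrite !inE eqxx.
have [d0|d2|d1] := ltngtP #|[set E in edges_in S | v \in E]| 1.
- have [I [M [IS indI MS tM le]]] := IHn _ leSv.
  have [|IS' indI' cI] := isoI I IS indI.
    move=> w wI; apply/negP=> vw; move: d0; rewrite ltnS leqn0 cards_eq0.
    move/eqP/setP/(_ [set v; w]); rewrite !inE edge_set2 vw eqxx subUset !sub1set vS.
    by have /setD1P[_ ->] := subsetP IS w wI.
  exists (v |: I), M; split=> //; last first.
    rewrite cS cI eS; move: le; move: #|S :\ v| #|edges_in (S :\ v)|.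
    by move: #|M| #|I| #|[set E in _ | _]|; clear; lia.
  exact: subset_trans MS (edges_inS SvS).
- have [I [M [IS indI MS tM le]]] := IHn _ leSv.
  exists I, M; split=> //; first exact: subset_trans IS SvS.
    exact: subset_trans MS (edges_inS SvS).
  rewrite cS eS; move: le d2; move: #|S :\ v| #|edges_in (S :\ v)|.
  by move: #|M| #|I| #|[set E in _ | _]|; clear; lia.
have /eqP/cards1P[E0 defE0] := d1.
have : E0 \in [set E in edges_in S | v \in E] by rewrite defE0 inE.
rewrite !inE -andbA => /and3P[E0G E0S vE0].
have [w vw E0E] := edge_at E0G vE0.
have wS : w \in S by apply: (subsetP E0S); rewrite E0E !inE eqxx orbT.
have nvw := adj_neq vw.
pose T := S :\ v :\ w.
have wSv : w \in S :\ v by rewrite !inE eq_sym nvw.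
have cT := cardsD1 w (S :\ v); rewrite wSv add1n in cT.
have TS : T \subset S :\ v by rewrite subsetDl.
have leT : #|T| < n by apply: ltnW; rewrite -cT.
have [I [M [IT indI MT tM le]]] := IHn T leT.
(* [E0] is the only edge of [S] at [v], and its other end [w] is not in [T]. *)
have [|IS' indI' cI] := isoI I (subset_trans IT TS) indI.
  move=> u uI; apply/negP=> vu.
  have : [set v; u] \in [set E in edges_in S | v \in E].
    rewrite !inE edge_set2 vu eqxx subUset !sub1set vS.
    by have := subsetP IT u uI; rewrite !inE => /and3P[_ _ ->].
  rewrite defE0 inE E0E => /eqP/setP/(_ u); rewrite !inE eqxx orbT.
  by have := subsetP IT u uI; rewrite !inE => /and3P[/negPf-> /negPf-> _].
have cM := cover_edges_in MT.
have [||tM' cM'] := set2_matchingU vw (subset_trans MT (edges_in_sub T)) tM.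
- by apply/negP=> /(subsetP cM); rewrite !inE eqxx andbF.
- by apply/negP=> /(subsetP cM); rewrite !inE eqxx.
exists (v |: I), ([set v; w] |: M); split=> //; last first.
  (* Losing [v] and [w] costs 4 on the left: one is paid by the edge [E0], one by its place in the
     matching, two by [v] in the independent set. *)
  have := subset_leq_card (edges_inS TS); rewrite cS cT -/T eS d1 cM' cI.
  move: le; move: #|T| #|edges_in T| #|edges_in (S :\ v)| #|M| #|I|.
  by clear; lia.
rewrite subUset sub1set inE -E0E E0G E0S.
exact: subset_trans MT (edges_inS (subset_trans TS SvS)).
Qed.

(** The edges inside [S] and the pairs of uncovered vertices are disjoint families of 2-subsets of
    [S]. *)
Lemma edges_in_le S M : M \subset edges_in S -> trivIset M ->
    independent (S :\: cover M) ->
  #|edges_in S| + 'C(#|S| - 2 * #|M|, 2) <= 'C(#|S|, 2).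
Proof.
move=> MS tM ind.
have cM := card_cover_matching (subset_trans MS (edges_in_sub S)) tM.
have <- : #|S :\: cover M| = #|S| - 2 * #|M|.
  by rewrite cardsDS ?cM // cover_edges_in.
rewrite -!cards_draws -cardsUI (_ : _ :&: _ = set0) ?cards0 ?addn0.
  apply/subset_leq_card/subsetP => E; rewrite !inE => /orP[/andP[EG ->]|].
    by rewrite card_edge.
  by case/andP=> /subset_trans-> //; rewrite subsetDl.
apply/setP=> E; rewrite !inE; apply/negP=> /andP[/andP[EG _] /andP[Esub _]].
have [x [y [xy e]]] := edgesP _ EG.
have h z : z \in E -> z \in S :\: cover M by move/(subsetP Esub).
by have := independentP _ ind x y; rewrite !h ?xy ?e ?inE ?eqxx ?orbT // => /(_ isT isT).
Qed.

(** * The upper bound for annihilating sets *)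

Lemma matching_le M : M \subset edges G -> trivIset M -> #|M| <= matching_number G.
Proof. by move=> MG tM; apply: leq_bigmax_cond; rewrite /matching MG. Qed.

Lemma independent_le S : independent S -> #|S| <= independence_number G.
Proof. exact: leq_bigmax_cond. Qed.

Lemma order_le_matching_independence :
  #|G| <= 2 * matching_number G + independence_number G.
Proof.
have [M [MS tM ind]] := exists_maximal_matching setT.
have MG := subset_trans MS (edges_in_sub _).
have := card_cover_matching MG tM; have := matching_le MG tM.
have := independent_le ind; have := subset_leq_card (subsetT (cover M)).
rewrite cardsDS ?subsetT // cardsT.
move: #|cover M| #|M| #|G| (matching_number G) (independence_number G).
by clear; lia.
Qed.

Lemma annihilating_set_bound A : \sum_(v in A) degree v <= nb_edges G ->
  #|A| <= 2 * matching_number G + 1 + independence_number G /\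
  6 * matching_number G <=
    (2 * matching_number G + 1 + independence_number G - #|A|) ^ 2.
Proof.
move=> sumA.
have [I [MA [IA indI MAA tMA leA]]] := card_le_edges_matching_independent A.
have [MB [MBB tMB indB]] := exists_maximal_matching (~: A).
have MAG := subset_trans MAA (edges_in_sub _).
have MBG := subset_trans MBB (edges_in_sub _).
have cMB := card_cover_matching MBG tMB.
(* The two matchings live on complementary sets, so their union is a matching of [G]. *)
have dAB : [disjoint cover MA & cover MB].
  rewrite disjoints_subset (subset_trans (cover_edges_in MAA)) //.
  by rewrite -setCS setCK cover_edges_in.
apply: annihilation_arith (cardsC A) order_le_matching_independence _
  (subset_leq_card MAA) _ (edges_in_le MBB tMB indB) _ _.
- by rewrite (leq_trans leA) // leq_add2l leq_mul2l independent_le.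
- by rewrite -(leq_add2l (nb_edges G)) -sum_degree_edges_in leq_add2r.
- by rewrite -cMB subset_leq_card // cover_edges_in.
- have MG : MA :|: MB \subset edges G by rewrite subUset MAG.
  have tM : trivIset (MA :|: MB) by apply: trivIsetU.
  rewrite (leq_trans _ (matching_le MG tM)) //.
  rewrite -(@leq_pmul2l 2) // mulnDr -cMB -!card_cover_matching //.
  by rewrite /cover bigcup_setU cardsU disjoint_setI0 // cards0 subn0.
Qed.

(** * Annihilation number in terms of vertex sets *)

Lemma annihilation_set :
  exists2 A : {set G}, #|A| = annihilation_number G &
    \sum_(v in A) degree v <= nb_edges G.
Proof.
rewrite /annihilation_number.
pose P (k : 'I_#|G|.+1) := sumn (take k (degree_sequence G)) <= nb_edges G.
have [|k kP ->] := @eq_bigmax_cond _ P (@nat_of_ord _).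
  by apply/card_gt0P; exists ord0; rewrite unfold_in /P take0.
(* Sorting the vertices by degree, instead of the degrees, exhibits the set behind the prefix. *)
pose s := take k (sort (relpre (@degree G) leq) (enum G)).
have us : uniq s by rewrite take_uniq // sort_uniq enum_uniq.
exists [set x in s].
  rewrite cardsE (card_uniqP us) size_takel // size_sort -cardE.
  by rewrite -ltnS.
rewrite (leq_trans _ kP) // /degree_sequence sort_map -map_take sumnE big_map.
by rewrite -/s (big_uniq _ us); apply: eq_leq; apply: eq_bigl => x; rewrite inE.
Qed.

(** The sorted degrees of [A] form a subsequence of the degree sequence, so the prefix of that
    length has no larger sum. *)
Lemma annihilation_number_ge A :
  \sum_(v in A) degree v <= nb_edges G -> #|A| <= annihilation_number G.
Proof.
move=> sumA; have kA : #|A| < #|G|.+1 by rewrite ltnS max_card.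
apply: (@leq_bigmax_cond _ (fun k : 'I__ => _ <= _) (fun k : 'I__ => k : nat)
  (Ordinal kA)) => /=.
rewrite (leq_trans _ sumA) //.
pose t := sort leq [seq degree v | v <- enum A].
have sub : subseq t (degree_sequence G).
  apply: (subseq_sort leq_total leq_trans); apply: map_subseq.
  by rewrite enumT; exact: filter_subseq.
have -> : #|A| = size t by rewrite size_sort size_map -cardE.
apply: leq_trans (sumn_take_le_subseq (sort_sorted leq_total _) sub) _.
rewrite /t (perm_sumn (s2 := [seq degree v | v <- enum A])) ?perm_sort //.
by rewrite sumnE big_map big_enum.
Qed.

End Graph.

(** * Disjoint unions of cliques, given by the fibres of a map *)

Section DisjointCliques.

Variables (V C : finType) (cls : V -> C).

Definition same_class : rel V := fun x y => (x != y) && (cls x == cls y).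

Lemma same_class_sym : symmetric same_class.
Proof. by move=> x y; rewrite /same_class eq_sym [cls x == _]eq_sym. Qed.

Lemma same_class_irrefl : irreflexive same_class.
Proof. by move=> x; rewrite /same_class eqxx. Qed.

Definition disjoint_cliques := SGraph same_class_sym same_class_irrefl.

Lemma degree_disjoint_cliques (v : disjoint_cliques) :
  (degree v).+1 = #|[set w | cls w == cls v]|.
Proof.
rewrite (cardsD1 v) inE eqxx add1n; congr _.+1; apply: eq_card => w.
by rewrite !inE /= /same_class eq_sym [cls v == _]eq_sym.
Qed.

(** The map [cls] is injective on an independent set. *)
Lemma independence_disjoint_cliques : independence_number disjoint_cliques <= #|C|.
Proof.
apply/bigmax_leqP => S /independentP indS.
rewrite -(card_in_imset (f := cls) (D := mem S)) ?max_card // => x y xS yS xy.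
by have := indS x y xS yS; rewrite /= /same_class xy eqxx andbT negbK => /eqP.
Qed.

(** Each edge lies in one fibre, and the matching edges in a fibre cover two of its vertices
    each. *)
Lemma matching_disjoint_cliques :
  matching_number disjoint_cliques <= \sum_c #|[set w | cls w == c]|./2.
Proof.
apply/bigmax_leqP => M /andP[MG tM].
pose B c : {set disjoint_cliques} := [set w | cls w == c].
have edgeB E : E \in M -> exists c, E \subset B c.
  move=> /(subsetP MG)/edgesP[x [y [/andP[_ /eqP xy] ->]]]; exists (cls x).
  by rewrite subUset !sub1set !inE xy eqxx.
apply: (@leq_trans (\sum_(E in M) \sum_(c | E \subset B c) 1)).
  rewrite -sum1_card; apply: leq_sum => E /edgeB[c Ec].
  by rewrite (bigD1 c) //= leq_addr.
rewrite (exchange_big_dep predT) //=; apply: leq_sum => c _.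
pose N := [set E in M | E \subset B c].
have NM : N \subset M by apply/subsetP=> E; rewrite inE => /andP[].
have tN : trivIset N by apply: trivIsetS tM.
rewrite sum1dep_card -/N geq_half_double -muln2 mulnC.
have cN := card_cover_matching (subset_trans NM MG) tN.
rewrite (leq_trans (eq_leq (esym cN))) // subset_leq_card //.
by apply/bigcupsP=> E; rewrite inE => /andP[].
Qed.

End DisjointCliques.

(** * An odd clique together with triangles *)

Section ExtremalGraph.

Variables h t : nat.

(** [None] labels the big clique, [Some i] the triangle of index [i]. *)
Definition component (v : 'I_(2 * h).+1 + 'I_t * 'I_3) : option 'I_t :=
  if v is inr (i, _) then Some i else None.

Definition clique_triangles : sgraph := disjoint_cliques component.

Lemma card_component_None : #|[set w | component w == None]| = (2 * h).+1.
Proof.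
have -> : [set w | component w == None] = [set inl i | i : 'I_(2 * h).+1].
  apply/setP=> -[i|[i j]]; rewrite inE /=; first by rewrite imset_f ?inE.
  by apply/esym/imsetP => -[].
by rewrite card_imset ?card_ord // => i i' [].
Qed.

Lemma card_component_Some i : #|[set w | component w == Some i]| = 3.
Proof.
have -> : [set w | component w == Some i] = [set inr (i, j) | j : 'I_3].
  apply/setP=> -[k|[k j]]; rewrite inE /=; first by apply/esym/imsetP => -[].
  by apply/eqP/imsetP => [[->]|[j' _ [-> _]] //]; exists j.
by rewrite card_imset ?card_ord // => j j' [].
Qed.

Lemma independence_clique_triangles : independence_number clique_triangles <= t.+1.
Proof.
by rewrite (leq_trans (independence_disjoint_cliques _)) // card_option card_ord.
Qed.

(** No matching is exhibited: the lower bound follows from the order [2 * h + 1 + 3 * t], the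
    independence number being at most [t + 1]. *)
Lemma matching_clique_triangles : matching_number clique_triangles = h + t.
Proof.
apply/eqP; rewrite eqn_leq; apply/andP; split.
  rewrite (leq_trans (matching_disjoint_cliques _)) // sum_option.
  apply: leq_add; first by rewrite card_component_None /= mul2n uphalf_double.
  under eq_bigr => i _ do rewrite card_component_Some.
  by rewrite sum_nat_const card_ord muln1.
have := order_le_matching_independence clique_triangles.
have := independence_clique_triangles.
rewrite card_sum card_prod !card_ord; lia.
Qed.

Lemma degree_clique (i : 'I_(2 * h).+1) : degree (inl i : clique_triangles) = 2 * h.
Proof. by apply/eq_add_S; rewrite degree_disjoint_cliques card_component_None. Qed.

Lemma degree_triangle (p : 'I_t * 'I_3) : degree (inr p : clique_triangles) = 2.
Proof.
by case: p => i j; apply/eq_add_S; rewrite degree_disjoint_cliques card_component_Some.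
Qed.

Lemma nb_edges_clique_triangles :
  nb_edges clique_triangles = (2 * h).+1 * h + 3 * t.
Proof.
apply/eqP; rewrite -(@eqn_pmul2l 2) // -handshake big_sumType /=.
under eq_bigr => i _ do rewrite degree_clique.
under [X in _ + X]eq_bigr => p _ do rewrite degree_triangle.
rewrite !sum_nat_const card_prod !card_ord; apply/eqP; lia.
Qed.

(** All triangles and [j] clique vertices have degree sum [6 * t + 2 * h * j]; the second hypothesis
    compares it with the number of edges after cancelling [3 * t]. *)
Lemma annihilation_clique_triangles (j : nat) : j <= (2 * h).+1 ->
    3 * t + 2 * h * j <= (2 * h).+1 * h ->
  3 * t + j <= annihilation_number clique_triangles.
Proof.
move=> le_j le_m.
pose inA (v : clique_triangles) := if v is inl i then i < j else true.
pose A := [set v | inA v].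
have cA (F : clique_triangles -> nat) a b :
    (forall i, F (inl i) = a) -> (forall p, F (inr p) = b) ->
  \sum_(v in A) F v = j * a + t * 3 * b.
  move=> Fl Fr; rewrite big_sumType /=; congr (_ + _).
    rewrite (eq_bigl (fun i : 'I__ => i < j)) => [|i]; last by rewrite inE.
    rewrite (eq_bigr (fun=> a)) // -(big_ord_widen _ (fun=> a) le_j).
    by rewrite sum_nat_const card_ord.
  rewrite (eq_bigl xpredT) => [|i]; last by rewrite inE.
  by rewrite (eq_bigr (fun=> b)) // sum_nat_const card_prod !card_ord.
have <- : #|A| = 3 * t + j by rewrite -sum1_card (cA _ 1 1) //; lia.
apply: annihilation_number_ge.
rewrite (cA _ (2 * h) 2) ?nb_edges_clique_triangles; first by lia.
- exact: degree_clique.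
- exact: degree_triangle.
Qed.

End ExtremalGraph.

(** One inequality is enough here, the upper bound giving its converse. The bound [s <= 2 * mu + 1]
    ensures [h <= mu], so that [mu - h] triangles make sense. *)
Lemma exists_extremal_graph (mu s : nat) :
    0 < mu -> 6 * mu <= s ^ 2 -> s <= 2 * mu + 1 ->
  exists G : sgraph, matching_number G = mu /\
    2 * mu + 1 + independence_number G <= annihilation_number G + s.
Proof.
move=> mu0 mus smu; have [h sh] : exists h, s = 2 * h \/ s = 2 * h + 1.
  exists s./2; have := odd_double_half s; case: odd; lia.
exists (clique_triangles h (mu - h)); split.
  by rewrite matching_clique_triangles; lia.
have := independence_clique_triangles h (mu - h).
have [j jE] : exists j, j + s = 2 * h + 2 by exists (2 * h + 2 - s); lia.
have ann : 3 * (mu - h) + j <= annihilation_number (clique_triangles h (mu - h)).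
  apply: annihilation_clique_triangles; first by lia.
  (* The edge condition amounts to [6 * mu <= s ^ 2] for even [s], and to [6 * mu <= s ^ 2 - 1] for
     odd [s], where parity gains the unit. *)
  by case: sh => ?; [have -> : j = 2 by lia|have -> : j = 1 by lia]; nia.
move: ann; move: (annihilation_number _) (independence_number _).
by clear -mu0 sh smu jE; lia.
Qed.

(** * Real square roots and the final statement *)

Import Order.TTheory GRing.Theory Num.Theory.

Local Open Scope ring_scope.

Lemma ceil_sqrt_le (R : realType) (a d : nat) :
  (Num.ceil (Num.sqrt (a%:R : R)) <= d%:Z) = (a <= d ^ 2)%N.
Proof.
rewrite ceil_le_int -pmulrn -[X in _ <= X](ger0_norm (ler0n R d)) -sqrtr_sqr.
by rewrite ler_sqrt ?sqr_ge0 // -natrX ler_nat.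
Qed.

Theorem theoremA (R : realType) :
  (forall G : sgraph, (1 <= matching_number G)%N ->
     (annihilation_number G)%:Z - (independence_number G)%:Z
       <= 2 * (matching_number G)%:Z + 1
          - Num.ceil (Num.sqrt (6 * (matching_number G)%:R : R)))
  /\
  (forall mu : nat, (1 <= mu)%N ->
     exists G : sgraph,
       matching_number G = mu /\
       (annihilation_number G)%:Z - (independence_number G)%:Z
         = 2 * mu%:Z + 1 - Num.ceil (Num.sqrt (6 * mu%:R : R))).
Proof.
have upper (G : sgraph) : (annihilation_number G)%:Z - (independence_number G)%:Z
    <= 2 * (matching_number G)%:Z + 1
       - Num.ceil (Num.sqrt (6 * (matching_number G)%:R : R)).
  have [A <- /annihilating_set_bound[leA]] := annihilation_set G.
  rewrite -(ceil_sqrt_le R) natrM.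
  move: (Num.ceil _) leA => s; lia.
split=> [G _|mu mu0]; first exact: upper.
have [s sE] : exists s : nat, Num.ceil (Num.sqrt (6 * mu%:R : R)) = s%:Z.
  exists `|Num.ceil (Num.sqrt (6 * mu%:R : R))|%N.
  by rewrite gez0_abs // ceil_ge0 (lt_le_trans _ (sqrtr_ge0 _)) // ltrN10.
(* So [s] is the least natural number whose square is at least [6 * mu]; [d := s] and
   [d := 2 * mu + 1] give the two hypotheses on [s]. *)
have s_le d : (s <= d)%N = (6 * mu <= d ^ 2)%N.
  by rewrite -(ceil_sqrt_le R) natrM sE.
have [||G [Gmu le]] := @exists_extremal_graph mu s mu0.
- by rewrite -s_le.
- by rewrite s_le; nia.
exists G; split=> //; have := upper G; rewrite Gmu sE; lia.
Qed.
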